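(* Let $\mathcal{V}$ be a variety of groups and let $G\in\mathcal{V}$ be an $m$-generated group, $m\ge 2$. Suppose $G$ contains a finitely generated subgroup $D$ of infinite index in $G$ such that $D$ discriminates the $\mathcal{V}$-free group $F_\infty(\mathcal{V})$ of countably infinite rank. Then for an arbitrary variety of groups $\mathcal{U}$, the $\mathcal{U}\mathcal{V}$-free group $F_\infty(\mathcal{U}\mathcal{V})$ of countably infinite rank is discriminated by some $m$-generated group belonging to $\mathcal{U}\mathcal{V}$. Consequently, the basis rank of $\mathcal{U}\mathcal{V}$ is at most $m$.
   Context: A group $G$ is discriminated by a group $D$ if for every finite subset $S\subset G$ there is a homomorphism $G\to D$ that is injective on $S$. For a variety $\mathcal{V}$, $F_\infty(\mathcal{V})$ is the relatively free group of $\mathcal{V}$ of countably infinite rank. The product $\mathcal{U}\mathcal{V}$ is the variety of all groups $G$ having a normal subgroup $N\in\mathcal{U}$ with $G/N\in\mathcal{V}$. A variety has basis rank $d$ if it is generated by its $d$-generated groups but not by its $(d-1)$-generated groups; ''basis rank at most $m$'' means it is generated by its $m$-generated groups. *)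

(* Defs.v *)
From Stdlib Require Import List.
Import ListNotations.

Record group := Group {
  carrier :> Type;
  gmul : carrier -> carrier -> carrier;
  gone : carrier;
  ginv : carrier -> carrier;
  gmulA : forall x y z, gmul x (gmul y z) = gmul (gmul x y) z;
  gmul1 : forall x, gmul gone x = x;
  gmulV : forall x, gmul (ginv x) x = gone
}.

Inductive word : Type :=
| Var : nat -> word
| WOne : word
| WMul : word -> word -> word
| WInv : word -> word.

Fixpoint eval (G : group) (f : nat -> G) (w : word) : G :=
  match w with
  | Var n => f n
  | WOne => gone G
  | WMul u v => gmul G (eval G f u) (eval G f v)
  | WInv u => ginv G (eval G f u)
  end.

Definition law := (word * word)%type.

Definition satisfies (G : group) (l : law) : Prop :=
  forall f : nat -> G, eval G f (fst l) = eval G f (snd l).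

Definition variety := law -> Prop.

Definition inV (V : variety) (G : group) : Prop :=
  forall l, V l -> satisfies G l.

Definition is_hom (G H : group) (phi : G -> H) : Prop :=
  forall x y, phi (gmul G x y) = gmul H (phi x) (phi y).

(* G belongs to the product variety UV: there is a normal subgroup N in U
   with G/N in V.  N is realised as the kernel of a surjective homomorphism
   phi : G -> H onto a group H (= G/N) in V; "N in U" means every U-law holds
   for all assignments of the variables into N. *)
Definition inProd (U V : variety) (G : group) : Prop :=
  exists (H : group) (phi : G -> H),
    is_hom G H phi /\ (forall h, exists g, phi g = h) /\ inV V H /\
    (forall l, U l -> forall f : nat -> G,
        (forall n, phi (f n) = gone H) -> eval G f (fst l) = eval G f (snd l)).

(* Elements of F_oo(V) are words modulo the equivalence
   "u = v is a law of every group in V" (resp. of every group in UV). *)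
Definition freeEq (V : variety) (u v : word) : Prop :=
  forall G : group, inV V G -> satisfies G (u, v).

Definition freeEqProd (U V : variety) (u v : word) : Prop :=
  forall G : group, inProd U V G -> satisfies G (u, v).

(* The subgroup D = {x | P x} of G discriminates the relatively free group
   whose element-equality is eqF: for every finite set of elements (given by
   representative words ws) there is a homomorphism F -> D (determined by an
   assignment of the free generators into D) injective on this set. *)
Definition discriminates (G : group) (P : G -> Prop)
    (eqF : word -> word -> Prop) : Prop :=
  forall ws : list word, exists f : nat -> G,
    (forall n, P (f n)) /\
    (forall u v, In u ws -> In v ws -> eval G f u = eval G f v -> eqF u v).

Definition is_subgroup (G : group) (P : G -> Prop) : Prop :=
  P (gone G) /\ (forall x y, P x -> P y -> P (gmul G x y)) /\
  (forall x, P x -> P (ginv G x)).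

Definition generated_by (G : group) (gens : list G) (P : G -> Prop) : Prop :=
  forall x, P x <-> exists w, eval G (fun n => nth n gens (gone G)) w = x.

Definition fin_gen_subgroup (G : group) (P : G -> Prop) : Prop :=
  exists gens : list G, generated_by G gens P.

Definition infinite_index (G : group) (P : G -> Prop) : Prop :=
  ~ exists reps : list G,
      forall g, exists r, In r reps /\ P (gmul G (ginv G r) g).

Definition m_generated (G : group) (m : nat) : Prop :=
  exists gens : list G, length gens = m /\ generated_by G gens (fun _ => True).

(* Main.v *)
(* Let [F] be free on [m] letters, [R] the kernel of [F -> G] and [K = F / U(R)].
   If [R] is trivial then [G] is free, so [V] contains every group, and [G] itself works.
   Otherwise the Schreier graph of [D] stays connected after removal of arbitrarily many
   well-chosen edges [e_n], because a nontrivial relator of [G] yields cycles far away from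
   any finite set.  So there are words [y_n] in [F], with prescribed value [d_n] in [D],
   whose path crosses [e_n] once and no other removed edge.  In a wreath product
   [M wr G] with [M] in [U], a lift of the generators of [G] amounts to labelling the
   edges of the Cayley graph by [M], and [y_n] read from [p] in [D] picks up an arbitrary label
   [a (n, p)].  Given [H] in [UV] with [M] in [U] normal and [H / M] in [V], discrimination of
   [F_oo(V)] by [D] allows labels that imitate, as in the Kaloujnine-Krasner embedding, the
   products of a given tuple of elements of [H], so words not equal in [H] differ in [K]. *)
Require Import Defs.
From Stdlib Require Import List Arith Lia ZArith.
From Stdlib Require Import FunctionalExtensionality PropExtensionality ProofIrrelevance ClassicalEpsilon.
Import ListNotations.

Local Notation "x ** y" := (gmul _ x y) (at level 40, left associativity).
Local Notation "x ^-1" := (ginv _ x) (at level 3, format "x ^-1").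
Local Notation "'e'" := (gone _).

(** * Groups, homomorphisms, letter words *)

Lemma gmulKV (G : group) (x y : G) : x^-1 ** (x ** y) = y.
Proof. now rewrite gmulA, gmulV, gmul1. Qed.

Lemma gmul_cancel (G : group) (x y z : G) : x ** y = x ** z -> y = z.
Proof. intros E. rewrite <- (gmulKV G x y), E. apply gmulKV. Qed.

Lemma gmulr1 (G : group) (x : G) : x ** e = x.
Proof. apply (gmul_cancel G x^-1). now rewrite gmulA, gmulV, gmul1. Qed.

Lemma gmulrV (G : group) (x : G) : x ** x^-1 = e.
Proof. apply (gmul_cancel G x^-1). now rewrite gmulA, gmulV, gmul1, gmulr1. Qed.

Lemma gmulK (G : group) (x y : G) : x ** (x^-1 ** y) = y.
Proof. now rewrite gmulA, gmulrV, gmul1. Qed.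

Lemma gmul_assoc (G : group) (x y z : G) : x ** y ** z = x ** (y ** z).
Proof. symmetry. apply gmulA. Qed.

Lemma ginv_unique (G : group) (x y : G) : x ** y = e -> y = x^-1.
Proof. intros E. apply (gmul_cancel G x). now rewrite E, gmulrV. Qed.

Lemma ginvM (G : group) (x y : G) : (x ** y)^-1 = y^-1 ** x^-1.
Proof. symmetry. apply ginv_unique. now rewrite gmul_assoc, gmulK, gmulrV. Qed.

Lemma ginvK (G : group) (x : G) : x^-1^-1 = x.
Proof. symmetry. apply ginv_unique, gmulV. Qed.

Lemma ginv1 (G : group) : (gone G)^-1 = e.
Proof. symmetry. apply ginv_unique, gmul1. Qed.

Create HintDb grp.
#[local] Hint Rewrite gmul_assoc gmul1 gmulr1 gmulV gmulrV gmulK gmulKV ginvM ginvK ginv1 : grp.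
Local Ltac grp := autorewrite with grp in *.

Lemma gmul_cancel_r (G : group) (x y z : G) : y ** x = z ** x -> y = z.
Proof.
  intros E. rewrite <- (gmulr1 G y), <- (gmulr1 G z), <- (gmulrV G x), !gmulA.
  now rewrite E.
Qed.

Lemma hom1 (G H : group) (phi : G -> H) : is_hom G H phi -> phi e = e.
Proof.
  intros Hphi. apply (gmul_cancel H (phi e)).
  now rewrite <- Hphi, gmul1, gmulr1.
Qed.

Lemma homV (G H : group) (phi : G -> H) (x : G) :
  is_hom G H phi -> phi x^-1 = (phi x)^-1.
Proof.
  intros Hphi. apply ginv_unique. rewrite <- Hphi, gmulrV. now apply hom1.
Qed.

Lemma hom_eval (G H : group) (phi : G -> H) (f : nat -> G) (w : word) :
  is_hom G H phi -> phi (eval G f w) = eval H (fun n => phi (f n)) w.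
Proof.
  intros Hphi. induction w as [n| |u IHu v IHv|u IHu]; simpl.
  - reflexivity.
  - now apply hom1.
  - now rewrite Hphi, IHu, IHv.
  - now rewrite (homV G H phi), IHu.
Qed.

Lemma eval_ext (G : group) (f g : nat -> G) (w : word) :
  (forall n, f n = g n) -> eval G f w = eval G g w.
Proof.
  intros E. induction w; simpl; congruence.
Qed.

Lemma eval_one (G : group) (w : word) : eval G (fun _ => e) w = e.
Proof.
  induction w as [n| |u IHu v IHv|u IHu]; simpl; trivial.
  - now rewrite IHu, IHv, gmul1.
  - now rewrite IHu, ginv1.
Qed.

(** Lists of signed letters over any index type replace [word] because prefixes and edge paths are
    read off a list directly. *)
Definition letter {G : group} {X : Type} (f : X -> G) (s : X * bool) : G :=
  if snd s then f (fst s) else (f (fst s))^-1.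

Fixpoint val {G : group} {X : Type} (f : X -> G) (z : list (X * bool)) : G :=
  match z with
  | [] => e
  | s :: z' => letter f s ** val f z'
  end.

Lemma val_cons {G : group} {X : Type} (f : X -> G) (s : X * bool) (z : list (X * bool)) :
  val f (s :: z) = letter f s ** val f z.
Proof. reflexivity. Qed.

Definition inv_letters {X : Type} (z : list (X * bool)) : list (X * bool) :=
  rev (map (fun s => (fst s, negb (snd s))) z).

Lemma inv_letters_cons {X : Type} (s : X * bool) (z : list (X * bool)) :
  inv_letters (s :: z) = inv_letters z ++ [(fst s, negb (snd s))].
Proof. reflexivity. Qed.

Lemma val_app {G : group} {X : Type} (f : X -> G) (z z' : list (X * bool)) :
  val f (z ++ z') = val f z ** val f z'.
Proof.
  induction z as [|s z IH]; simpl.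
  - now rewrite gmul1.
  - now rewrite IH, gmulA.
Qed.

Lemma letter_negb {G : group} {X : Type} (f : X -> G) (x : X) (b : bool) :
  letter f (x, negb b) = (letter f (x, b))^-1.
Proof. destruct b; unfold letter; simpl; now rewrite ?ginvK. Qed.

Lemma val_inv {G : group} {X : Type} (f : X -> G) (z : list (X * bool)) :
  val f (inv_letters z) = (val f z)^-1.
Proof.
  induction z as [|[x b] z IH]; simpl.
  - now rewrite ginv1.
  - now rewrite inv_letters_cons, val_app, IH, ginvM; simpl; rewrite letter_negb, gmulr1.
Qed.

Lemma hom_val (G H : group) (phi : G -> H) (X : Type) (f : X -> G) (z : list (X * bool)) :
  is_hom G H phi -> phi (val f z) = val (fun x => phi (f x)) z.
Proof.
  intros Hphi. induction z as [|[x b] z IH]; simpl.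
  - now apply hom1.
  - rewrite Hphi, IH. destruct b; unfold letter; simpl; trivial.
    now rewrite (homV G H phi).
Qed.

Lemma val_ext {G : group} {X : Type} (f g : X -> G) (z : list (X * bool)) :
  (forall x, f x = g x) -> val f z = val g z.
Proof.
  intros E. induction z as [|[x b] z IH]; simpl; trivial.
  rewrite IH. unfold letter; simpl. now rewrite E.
Qed.

Fixpoint letters (w : word) : list (nat * bool) :=
  match w with
  | Var n => [(n, true)]
  | WOne => []
  | WMul u v => letters u ++ letters v
  | WInv u => inv_letters (letters u)
  end.

Lemma val_letters (G : group) (f : nat -> G) (w : word) :
  val f (letters w) = eval G f w.
Proof.
  induction w as [n| |u IHu v IHv|u IHu]; simpl; trivial.
  - apply gmulr1.
  - now rewrite val_app, IHu, IHv.
  - now rewrite val_inv, IHu.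
Qed.

Fixpoint word_of (z : list (nat * bool)) : word :=
  match z with
  | [] => WOne
  | (n, b) :: z' => WMul (if b then Var n else WInv (Var n)) (word_of z')
  end.

Lemma eval_word_of (G : group) (f : nat -> G) (z : list (nat * bool)) :
  eval G f (word_of z) = val f z.
Proof.
  induction z as [|[n b] z IH]; simpl; trivial.
  rewrite IH. now destruct b.
Qed.

(** Two words for the same element differ by a relator of [g], which [h] kills; hence sending
    [val g z] to [val h z] is well defined. *)
Lemma hom_extension (G H : group) (X : Type) (g : X -> G) (h : X -> H) :
  (forall k, exists z, val g z = k) ->
  (forall z, val g z = e -> val h z = e) ->
  exists psi : G -> H, is_hom G H psi /\ forall x, psi (g x) = h x.
Proof.
  intros Hgen Hker.
  assert (Hwd : forall z z', val g z = val g z' -> val h z = val h z').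
  { intros z z' E. apply (gmul_cancel_r H (val h z')^-1).
    rewrite gmulrV, <- val_inv, <- val_app. apply Hker.
    now rewrite val_app, val_inv, E, gmulrV. }
  destruct (choice _ Hgen) as [lift Hlift].
  exists (fun k => val h (lift k)). split.
  - intros x y. rewrite <- val_app. apply Hwd. now rewrite val_app, !Hlift.
  - intros x. rewrite <- (gmulr1 H (h x)). change (h x ** e) with (val h [(x, true)]).
    apply Hwd. rewrite Hlift. simpl. symmetry. apply gmulr1.
Qed.

(** * Wreath products and kernels *)

Lemma sig_eq {A : Type} (P : A -> Prop) (x y : {a | P a}) :
  proj1_sig x = proj1_sig y -> x = y.
Proof. apply eq_sig_hprop. intros. apply proof_irrelevance. Qed.

(** The unrestricted wreath product, since labels will live on whole orbits of edges. The translate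
    [y ** fst a] makes the base part of a product, taken at [y], collect labels along a path that
    starts at [y]. *)
Definition wreath (M G : group) : group.
Proof.
  refine (Group (G * (G -> M))
    (fun a b => (fst a ** fst b, fun y => snd a y ** snd b (y ** fst a)))
    (e, fun _ => e)
    (fun a => ((fst a)^-1, fun y => (snd a (y ** (fst a)^-1))^-1)) _ _ _).
  - intros [g a] [h b] [k c]; simpl. f_equal; [apply gmulA|].
    extensionality y. now rewrite !gmulA.
  - intros [g a]; simpl. f_equal; [apply gmul1|].
    extensionality y. now rewrite gmul1, gmulr1.
  - intros [g a]; simpl. f_equal; [apply gmulV|].
    extensionality y. apply gmulV.
Defined.

Definition top {M G : group} (a : wreath M G) : G := fst a.
Definition base {M G : group} (a : wreath M G) : G -> M := snd a.

Lemma top_hom (M G : group) : is_hom (wreath M G) G top.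
Proof. intros x y. reflexivity. Qed.

Lemma wreath_eval_top (M G : group) (f : nat -> wreath M G) (w : word) :
  (forall n, top (f n) = e) -> top (eval (wreath M G) f w) = e.
Proof.
  intros Hf. rewrite (hom_eval _ _ top f w (top_hom M G)).
  rewrite (eval_ext G _ (fun _ => e)) by exact Hf. apply eval_one.
Qed.

Lemma wreath_eval_base (M G : group) (f : nat -> wreath M G) (w : word) (y : G) :
  (forall n, top (f n) = e) ->
  base (eval (wreath M G) f w) y = eval M (fun n => base (f n) y) w.
Proof.
  intros Hf. revert y. induction w as [n| |u IHu v IHv|u IHu]; intros y; simpl; trivial.
  - change (base (eval (wreath M G) f u) y **
      base (eval (wreath M G) f v) (y ** top (eval (wreath M G) f u)) =
      eval M (fun n => base (f n) y) u ** eval M (fun n => base (f n) y) v).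
    now rewrite wreath_eval_top, gmulr1, IHu, IHv.
  - change ((base (eval (wreath M G) f u) (y ** (top (eval (wreath M G) f u))^-1))^-1 =
      (eval M (fun n => base (f n) y) u)^-1).
    now rewrite wreath_eval_top, ginv1, gmulr1, IHu.
Qed.

Definition ker_group (H Q : group) (phi : H -> Q) (Hphi : is_hom H Q phi) : group.
Proof.
  unshelve refine (Group {h : H | phi h = e}
    (fun a b => exist _ (proj1_sig a ** proj1_sig b) _)
    (exist _ e _)
    (fun a => exist _ (proj1_sig a)^-1 _) _ _ _).
  - now rewrite Hphi, (proj2_sig a), (proj2_sig b), gmul1.
  - now apply hom1.
  - now rewrite (homV H Q phi), (proj2_sig a), ginv1.
  - intros x y z. apply sig_eq, gmulA.
  - intros x. apply sig_eq, gmul1.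
  - intros x. apply sig_eq, gmulV.
Defined.

Definition ker_incl (H Q : group) (phi : H -> Q) (Hphi : is_hom H Q phi) :
  ker_group H Q phi Hphi -> H := @proj1_sig _ _.

Lemma ker_incl_hom (H Q : group) (phi : H -> Q) (Hphi : is_hom H Q phi) :
  is_hom _ _ (ker_incl H Q phi Hphi).
Proof. intros x y. reflexivity. Qed.

Definition ker_laws (U : variety) (H Q : group) (phi : H -> Q) : Prop :=
  forall l, U l -> forall f : nat -> H,
    (forall n, phi (f n) = e) -> eval H f (fst l) = eval H f (snd l).

Lemma ker_group_inV (U : variety) (H Q : group) (phi : H -> Q) (Hphi : is_hom H Q phi) :
  ker_laws U H Q phi -> inV U (ker_group H Q phi Hphi).
Proof.
  intros HU l Hl f. apply sig_eq.
  change (ker_incl H Q phi Hphi (eval (ker_group H Q phi Hphi) f (fst l))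
          = ker_incl H Q phi Hphi (eval (ker_group H Q phi Hphi) f (snd l))).
  rewrite !(hom_eval _ _ _ f _ (ker_incl_hom H Q phi Hphi)).
  apply HU; trivial. intros n. exact (proj2_sig (f n)).
Qed.

(** The kernel of [top] is a direct power of [M], where words are evaluated coordinate by
    coordinate. *)
Lemma wreath_ker_laws (U : variety) (M G : group) :
  inV U M -> ker_laws U (wreath M G) G top.
Proof.
  intros HM l Hl f Hf. apply injective_projections.
  - change (top (eval (wreath M G) f (fst l)) = top (eval (wreath M G) f (snd l))).
    now rewrite !wreath_eval_top.
  - extensionality y.
    change (base (eval (wreath M G) f (fst l)) y = base (eval (wreath M G) f (snd l)) y).
    rewrite !wreath_eval_base by exact Hf. now apply HM.
Qed.

Lemma id_ker_laws (U : variety) (G : group) : ker_laws U G G (fun x => x).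
Proof.
  intros l _ f Hf. rewrite !(eval_ext G f (fun _ => e)) by exact Hf.
  now rewrite !eval_one.
Qed.

(** * The covering group *)

(** The group laws are asked only modulo [R], so that [W] can be the type of letter words. The
    carrier consists of chosen representatives. *)
Lemma quotient_group (W : Type) (op : W -> W -> W) (one : W) (inv : W -> W)
    (R : W -> W -> Prop) :
  (forall a, R a a) -> (forall a b, R a b -> R b a) ->
  (forall a b c, R a b -> R b c -> R a c) ->
  (forall a a' b b', R a a' -> R b b' -> R (op a b) (op a' b')) ->
  (forall a a', R a a' -> R (inv a) (inv a')) ->
  (forall a b c, R (op a (op b c)) (op (op a b) c)) ->
  (forall a, R (op one a) a) -> (forall a, R (op (inv a) a) one) ->
  exists (K : group) (c : W -> K),
    (forall k, exists w, c w = k) /\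
    (forall a b, c a = c b <-> R a b) /\
    (forall a b, c (op a b) = c a ** c b).
Proof.
  intros Rrefl Rsym Rtrans Rop Rinv RA R1 RV.
  pose (rep := fun a => epsilon (inhabits one) (R a)).
  assert (Hrep : forall a, R a (rep a)).
  { intros a. unfold rep. apply epsilon_spec. now exists a. }
  (* For equivalent [a] and [b] the predicates [R a] and [R b] are equal, so [epsilon] makes the
     same choice. *)
  assert (Hrep_eq : forall a b, R a b -> rep a = rep b).
  { intros a b Rab. unfold rep. f_equal. extensionality w.
    apply propositional_extensionality. split; eauto. }
  assert (Hrepr : forall a, rep (rep a) = rep a) by (intros a; symmetry; auto).
  pose (c := fun a => exist (fun a => rep a = a) (rep a) (Hrepr a)).
  assert (cR : forall a b, R a b -> c a = c b).
  { intros a b Rab. apply sig_eq; simpl. now apply Hrep_eq. }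
  assert (cK : forall k, c (proj1_sig k) = k).
  { intros [k Hk]. apply sig_eq. exact Hk. }
  unshelve eexists (Group {a | rep a = a}
    (fun a b => c (op (proj1_sig a) (proj1_sig b)))
    (c one) (fun a => c (inv (proj1_sig a))) _ _ _).
  - intros x y z. apply cR. simpl.
    eapply Rtrans; [apply Rop; [apply Rrefl | apply Rsym, Hrep]|].
    eapply Rtrans; [apply RA|]. apply Rop; [apply Hrep | apply Rrefl].
  - intros x. rewrite <- (cK x) at 2. apply cR. simpl.
    eapply Rtrans; [apply Rop; [apply Rsym, Hrep | apply Rrefl]|]. apply R1.
  - intros x. apply cR. simpl.
    eapply Rtrans; [apply Rop; [apply Rsym, Hrep | apply Rrefl]|]. apply RV.
  - exists c. split; [|split].
    + intros k. exists (proj1_sig k). apply cK.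
    + intros a b. split; [|apply cR]. intros E. apply (f_equal (@proj1_sig _ _)) in E.
      simpl in E. apply Rtrans with (rep a); [apply Hrep|]. rewrite E. apply Rsym, Hrep.
    + intros a b. apply cR. simpl. apply Rop; apply Hrep.
Qed.

(* [K] is [F / U(R)], where [F] is free on [X] and [R] is the kernel of [F -> G]. *)
Lemma covering_group (U : variety) (G : group) (X : Type) (g : X -> G) :
  (forall k, exists z, val g z = k) ->
  exists (K : group) (kappa : X -> K) (p : K -> G),
    (forall k, exists z, val kappa z = k) /\
    is_hom K G p /\ (forall x, p (kappa x) = g x) /\ ker_laws U K G p /\
    (forall (H : group) (phi : H -> G) (f : X -> H),
       is_hom H G phi -> ker_laws U H G phi -> (forall x, phi (f x) = g x) ->
       exists psi : K -> H, is_hom K H psi /\ forall x, psi (kappa x) = f x).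
Proof.
  intros Hgen.
  pose (test := fun (H : group) (phi : H -> G) (f : X -> H) =>
    is_hom H G phi /\ ker_laws U H G phi /\ (forall x, phi (f x) = g x)).
  (* Words are identified when no test triple separates them. This builds in the universal property
     and avoids forming a verbal subgroup. *)
  pose (R := fun z z' => forall H phi f, test H phi f -> val f z = val f z').
  destruct (quotient_group (list (X * bool)) (@app _) [] (@inv_letters X) R)
    as (K & c & Hsurj & HcR & Hc).
  - intros a H phi f _. reflexivity.
  - intros a b Rab H phi f T. symmetry. eapply Rab; eassumption.
  - intros a b d Rab Rbd H phi f T. rewrite (Rab H phi f T). now apply (Rbd H phi f).
  - intros a a' b b' Ra Rb H phi f T.
    now rewrite !val_app, (Ra H phi f T), (Rb H phi f T).
  - intros a a' Ra H phi f T. now rewrite !val_inv, (Ra H phi f T).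
  - intros a b d H phi f _. now rewrite app_assoc.
  - intros a H phi f _. reflexivity.
  - intros a H phi f _. now rewrite val_app, val_inv, gmulV.
  - pose (kappa := fun x => c [(x, true)]).
    assert (c1 : c [] = e).
    { apply (gmul_cancel K (c [])). now rewrite <- Hc, gmulr1. }
    assert (Hval : forall z, val kappa z = c z).
    { induction z as [|[x b] z IH]; simpl; [now symmetry|].
      change ((x, b) :: z) with ([(x, b)] ++ z). rewrite Hc, IH. f_equal.
      destruct b; unfold letter; simpl; trivial.
      symmetry. apply ginv_unique. unfold kappa. rewrite <- Hc, <- c1. apply HcR.
      intros H phi f _. simpl. unfold letter; simpl. now grp. }
    assert (Hext : forall H phi f, test H phi f ->
      exists psi : K -> H, is_hom K H psi /\ forall x, psi (kappa x) = f x).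
    { intros H phi f T. apply hom_extension.
      - intros k. destruct (Hsurj k) as [z <-]. exists z. apply Hval.
      - intros z. rewrite Hval, <- c1. intros E. apply HcR in E.
        exact (E H phi f T). }
    (* [G] over itself is a test triple, its kernel being trivial. *)
    destruct (Hext G (fun x => x) g) as (p & Hp & Hpk).
    { split; [intros x y; reflexivity|]. split; [apply id_ker_laws|reflexivity]. }
    exists K, kappa, p.
    split; [|split; [exact Hp|split; [exact Hpk|split]]].
    + intros k. destruct (Hsurj k) as [z <-]. exists z. apply Hval.
    (* The law is checked in each test group: there [phi] after [psi] is [p], so the assignment
       lands in the kernel of [phi], which satisfies it. *)
    + intros l Hl f Hf.
      destruct (Hsurj (eval K f (fst l))) as [a Ha], (Hsurj (eval K f (snd l))) as [b Hb].
      rewrite <- Ha, <- Hb. apply HcR. intros H phi h T.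
      destruct (Hext H phi h T) as (psi & Hpsi & Hpsik).
      assert (Hh : forall z, val h z = psi (c z)).
      { intros z. rewrite <- Hval, (hom_val _ _ psi) by exact Hpsi.
        apply val_ext. intros x. now rewrite Hpsik. }
      rewrite !Hh, Ha, Hb, !(hom_eval _ _ psi) by exact Hpsi.
      destruct T as (Tphi & TU & Tg). apply TU; trivial.
      intros n. rewrite <- (Hf n). destruct (Hsurj (f n)) as [z <-].
      rewrite <- Hh, <- Hval, (hom_val _ _ phi), (hom_val _ _ p) by assumption.
      apply val_ext. intros x. now rewrite Tg, Hpk.
    + intros H phi f H1 H2 H3. apply (Hext H phi f). now split.
Qed.

(** * Paths in the Schreier graph of a subgroup *)

Section Schreier.

Context (G : group) (D : G -> Prop) (HD : is_subgroup G D) (X : Type) (g : X -> G).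

(** Equality of right cosets of [D], the vertices of the Schreier graph. That graph is never formed:
    its edge sets appear as [D]-invariant sets of edges of the Cayley graph, and its closed paths as
    paths with [cos]-related ends. *)
Definition cos (a b : G) : Prop := D (a ** b^-1).

Lemma cos_refl (a : G) : cos a a.
Proof. unfold cos. rewrite gmulrV. apply HD. Qed.

Lemma cos_sym (a b : G) : cos a b -> cos b a.
Proof.
  unfold cos. intros H. apply HD in H. now rewrite ginvM, ginvK in H.
Qed.

Lemma cos_trans (a b c : G) : cos a b -> cos b c -> cos a c.
Proof.
  unfold cos. intros H1 H2. destruct HD as (_ & Hmul & _).
  generalize (Hmul _ _ H1 H2). now grp.
Qed.

Lemma cos_mul (a b c : G) : cos a b -> cos (a ** c) (b ** c).
Proof. unfold cos. now grp. Qed.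

Lemma cos_mul_l (a b c : G) : cos (a ** c) b -> cos a (b ** c^-1).
Proof. unfold cos. now grp. Qed.

Lemma cos_mul_r (a b c : G) : cos (a ** c^-1) b -> cos a (b ** c).
Proof. unfold cos. now grp. Qed.

Lemma cos_D (d : G) : D d -> cos d e.
Proof. unfold cos. now grp. Qed.

(* The edge [(w, x)] joins [w] to [w ** g x]. *)
Definition source (v : G) (s : X * bool) : G :=
  if snd s then v else v ** (g (fst s))^-1.

Fixpoint edges (v : G) (z : list (X * bool)) : list (G * X) :=
  match z with
  | [] => []
  | s :: z' => (source v s, fst s) :: edges (v ** letter g s) z'
  end.

Definition avoid (B : G * X -> Prop) (v : G) (z : list (X * bool)) : Prop :=
  forall a, In a (edges v z) -> ~ B a.

Definition orbit (a b : G * X) : Prop := snd b = snd a /\ cos (fst b) (fst a).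

Definition invariant (B : G * X -> Prop) : Prop :=
  forall a b, orbit a b -> B a -> B b.

Lemma orbit_sym (a b : G * X) : orbit a b -> orbit b a.
Proof. intros [H1 H2]. split; [congruence | now apply cos_sym]. Qed.

Lemma orbit_trans (a b c : G * X) : orbit a b -> orbit b c -> orbit a c.
Proof.
  intros [H1 H2] [H3 H4]. split; [congruence | eapply cos_trans; eassumption].
Qed.

Lemma orbit_source (v v' : G) (s : X * bool) :
  cos v v' -> orbit (source v s, fst s) (source v' s, fst s).
Proof.
  intros H. split; [reflexivity|]. apply cos_sym. unfold source; simpl.
  destruct (snd s); [exact H | now apply cos_mul].
Qed.

Lemma avoid_cons (B : G * X -> Prop) (v : G) (s : X * bool) (z : list (X * bool)) :
  avoid B v (s :: z) <-> ~ B (source v s, fst s) /\ avoid B (v ** letter g s) z.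
Proof.
  unfold avoid; simpl. split.
  - intros H. split; intros; apply H; auto.
  - intros [H1 H2] a [<-|Ha]; auto.
Qed.

Lemma avoid_app (B : G * X -> Prop) (v : G) (z z' : list (X * bool)) :
  avoid B v (z ++ z') <-> avoid B v z /\ avoid B (v ** val g z) z'.
Proof.
  revert v. induction z as [|s z IH]; intros v; simpl.
  - rewrite gmulr1. split; [intros H; split; trivial; intros a [] | tauto].
  - rewrite !avoid_cons, IH, gmulA. tauto.
Qed.

(** An invariant set of edges comes from the Schreier graph, where the two paths coincide. *)
Lemma avoid_cos (B : G * X -> Prop) (v v' : G) (z : list (X * bool)) :
  invariant B -> cos v v' -> avoid B v z -> avoid B v' z.
Proof.
  intros HB. revert v v'. induction z as [|s z IH]; intros v v' Hv; [intros _ a []|].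
  rewrite !avoid_cons. intros [H1 H2]. split.
  - intros H. apply H1. revert H. apply HB, orbit_source. now apply cos_sym.
  - revert H2. apply IH. now apply cos_mul.
Qed.

Lemma avoid_inv (B : G * X -> Prop) (v : G) (z : list (X * bool)) :
  avoid B v z -> avoid B (v ** val g z) (inv_letters z).
Proof.
  revert v. induction z as [|[x b] z IH]; intros v; [intros _ a []|].
  rewrite avoid_cons, inv_letters_cons, avoid_app. simpl val. intros [H1 H2]. split.
  - apply IH in H2. now rewrite <- gmulA in H2.
  - rewrite avoid_cons. split; [|intros a []].
    rewrite val_inv. intros H. apply H1. revert H. unfold source, letter; simpl.
    destruct b; simpl; now grp.
Qed.

Lemma avoid_mono (B B' : G * X -> Prop) (v : G) (z : list (X * bool)) :
  (forall a, B a -> B' a) -> avoid B' v z -> avoid B v z.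
Proof. intros H HB a Ha Hb. apply (HB a Ha). auto. Qed.

Lemma avoid_or_cross (B : G * X -> Prop) (v : G) (z : list (X * bool)) :
  avoid B v z \/
  exists z1 s z2, z = z1 ++ s :: z2 /\ B (source (v ** val g z1) s, fst s).
Proof.
  revert v. induction z as [|s z IH]; intros v; [left; intros a []|].
  destruct (classic (B (source v s, fst s))) as [Hs|Hs].
  - right. exists [], s, z. simpl. now rewrite gmulr1.
  - destruct (IH (v ** letter g s)) as [H|(z1 & t & z2 & -> & H)].
    + left. now rewrite avoid_cons.
    + right. exists (s :: z1), t, z2. simpl. now rewrite gmulA.
Qed.

(** Triviality in the free group on [X], tested in all groups so that no reduced forms are
    involved. *)
Definition trivial_word (z : list (X * bool)) : Prop :=
  forall (H : group) (f : X -> H), val f z = e.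

(* A closed path either freely reduces to the empty word, or the subgraph it
   traverses is not a forest and so has an edge that is not a bridge. *)
Lemma closed_path_bypass (B : G * X -> Prop) (z : list (X * bool)) (v : G) :
  invariant B -> cos (v ** val g z) v -> avoid B v z ->
  trivial_word z \/
  exists w x z', ~ B (w, x) /\
    avoid (fun a => B a \/ orbit (w, x) a) (w ** g x) z' /\
    cos (w ** g x ** val g z') w.
Proof.
  intros HB. remember (length z) as n eqn:Hn. revert z v Hn.
  induction n as [n IH] using (well_founded_induction lt_wf).
  intros z v Hn Hclosed Hz.
  destruct z as [|[x b] z]; [left; intros H f; reflexivity|].
  rewrite avoid_cons in Hz. destruct Hz as [Hs Hz]. simpl in Hclosed, Hn.
  set (a := (source v (x, b), x)).
  destruct (avoid_or_cross (orbit a) (v ** letter g (x, b)) z)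
    as [Hav|(z1 & [x' b'] & z2 & -> & [Hx Hcos])].
  (* The first edge is never crossed again, so the rest of the closed path, reversed if the first
     letter is an inverse, joins its ends. *)
  { right. assert (Hav' : avoid (fun c => B c \/ orbit a c) (v ** letter g (x, b)) z).
    { intros c Hc [H|H]; [now apply (Hz c) | now apply (Hav c)]. }
    assert (HB' : invariant (fun c => B c \/ orbit a c)).
    { intros c c' Hcc [H|H]; [left; now apply (HB c)|right].
      eapply orbit_trans; eassumption. }
    exists (source v (x, b)), x. unfold a, source, letter in *. simpl in *. destruct b.
    - exists z. split; [exact Hs|]. split; [exact Hav'|]. now rewrite <- gmulA.
    - exists (inv_letters z). split; [exact Hs|]. apply avoid_inv in Hav'.
      grp. split.
      + revert Hav'. now apply avoid_cos.
      + rewrite val_inv. apply cos_sym. apply cos_mul_l. now grp. }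
  simpl in Hx. subst x'. simpl fst in Hcos. simpl snd in Hcos.
  rewrite avoid_app, avoid_cons in Hz. destruct Hz as (Hz1 & Hs' & Hz2).
  rewrite val_app in Hclosed. simpl in Hclosed.
  rewrite length_app in Hn. simpl in Hn.
  unfold source, letter in *. simpl in Hcos, Hs, Hs', Hz1, Hz2, Hclosed.
  destruct (Bool.bool_dec b b') as [<-|Hbb].
  (* A second crossing in the same direction cuts the path into two shorter closed paths, each
     starting with [(x, b)]. *)
  - assert (H1 : cos (v ** letter g (x, b) ** val g z1) v).
    { unfold letter; simpl. destruct b; [exact Hcos|].
      apply cos_mul_r in Hcos. now grp. }
    destruct (IH (S (length z1)) ltac:(lia) ((x, b) :: z1) v eq_refl) as [T1|?];
      [simpl; now rewrite gmulA | rewrite avoid_cons; now split | | now right].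
    destruct (IH (S (length z2)) ltac:(lia) ((x, b) :: z2)
      (v ** letter g (x, b) ** val g z1) eq_refl) as [T2|?];
      [ | rewrite avoid_cons; now split | | now right].
    { apply cos_trans with v; [|now apply cos_sym].
      simpl. unfold letter; simpl. now rewrite <- !gmulA in *. }
    left. intros H f. generalize (T1 H f), (T2 H f). simpl. rewrite val_app. simpl.
    intros E1 E2. now rewrite gmulA, E1, gmul1.
  (* A crossing in the opposite direction leaves [z1] and [z2] closed; if both are trivial, the two
     letters cancel. *)
  - assert (H1 : cos (v ** letter g (x, b) ** val g z1) (v ** letter g (x, b))).
    { unfold letter; simpl.
      destruct b, b'; first [congruence | now apply cos_mul_r]. }
    destruct (IH (length z1) ltac:(lia) z1 (v ** letter g (x, b)) eq_refl H1)
      as [T1|?]; [exact Hz1| |now right].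
    destruct (IH (length z2) ltac:(lia) z2
      (v ** letter g (x, b) ** val g z1 ** letter g (x, b')) eq_refl) as [T2|?];
      [ | exact Hz2 | | now right].
    { apply cos_trans with v.
      - unfold letter; simpl. now rewrite <- !gmulA in *.
      - apply (cos_mul _ _ (letter g (x, b'))) in H1. apply cos_sym.
        apply cos_trans with (1 := H1).
        replace (v ** letter g (x, b) ** letter g (x, b')) with v; [apply cos_refl|].
        unfold letter; simpl. destruct b, b'; try congruence; now grp. }
    left. intros H f. generalize (T1 H f), (T2 H f). simpl. rewrite val_app. simpl.
    intros E1 E2. rewrite E1, E2. unfold letter; simpl.
    destruct b, b'; try congruence; now grp.
Qed.

Context (Hgen : forall k, exists z, val g z = k).

(** [l] collects the edges of one path from [e] to each generator of [D]. Products of generators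
    follow these paths again from vertices in [D], hence in the same orbits of edges. *)
Lemma subgroup_paths :
  fin_gen_subgroup G D ->
  exists l : list (G * X), forall B, invariant B -> (forall a, In a l -> ~ B a) ->
    forall d, D d -> exists z, avoid B e z /\ val g z = d.
Proof.
  intros [L HL]. destruct (choice _ Hgen) as [lift Hlift].
  exists (flat_map (fun k => edges e (lift k)) L). intros B HB Hl.
  assert (HDw : forall w, D (eval G (fun n => nth n L e) w)) by (intros w; apply HL; eauto).
  assert (Hw : forall w, exists z, avoid B e z /\ val g z = eval G (fun n => nth n L e) w).
  { induction w as [n| |u (zu & Hu & Eu) v (zv & Hv & Ev)|u (zu & Hu & Eu)]; simpl.
    - destruct (nth_in_or_default n L e) as [Hn| ->].
      + exists (lift (nth n L e)). split; [|apply Hlift].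
        intros a Ha. apply Hl, in_flat_map. eauto.
      + exists []. split; [intros a [] | reflexivity].
    - exists []. split; [intros a [] | reflexivity].
    - exists (zu ++ zv). rewrite avoid_app, val_app, Eu, Ev. repeat split; trivial.
      revert Hv. apply avoid_cos; trivial. rewrite gmul1. apply cos_sym, cos_D, HDw.
    - exists (inv_letters zu). rewrite val_inv, Eu. split; trivial.
      apply avoid_inv in Hu. revert Hu. apply avoid_cos; trivial.
      rewrite gmul1, Eu. apply cos_D, HDw. }
  intros d Hd. apply HL in Hd. destruct Hd as [w <-]. apply Hw.
Qed.

Lemma edges_translate (v w : G) (z : list (X * bool)) :
  edges (v ** w) z = map (fun a => (v ** fst a, snd a)) (edges w z).
Proof.
  revert w. induction z as [|[x b] z IH]; intros w; simpl; trivial.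
  rewrite <- IH, gmulA. f_equal. f_equal. unfold source; simpl.
  destruct b; trivial. now rewrite gmulA.
Qed.

(** [infinite_index] speaks of left cosets and [cos] of right ones; inversion exchanges them. *)
Lemma far_vertex (l : list G) :
  infinite_index G D -> exists v, forall r, In r l -> ~ cos v r.
Proof.
  intros Hinf. apply NNPP. intros Hno. apply Hinf. exists (map (ginv G) l).
  intros v. apply NNPP. intros Hv. apply Hno. exists v^-1. intros r Hr Hc.
  apply Hv. exists r^-1. split; [now apply in_map|].
  apply cos_sym in Hc. unfold cos in Hc. rewrite ginvK in *. exact Hc.
Qed.

(** An edge [a] of the path from [e], translated by [v], meets the orbit of [b] only if [v] lies in
    the coset of [fst b ** (fst a)^-1]. Finitely many cosets are thus to be avoided. *)
Lemma far_path (l : list (G * X)) (z : list (X * bool)) :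
  infinite_index G D ->
  exists v, avoid (fun a => exists b, In b l /\ orbit b a) v z.
Proof.
  intros Hinf.
  destruct (far_vertex (flat_map (fun b => map (fun a => fst b ** (fst a)^-1) (edges e z)) l)
    Hinf) as [v Hv].
  exists v. intros a Ha (b & Hb & _ & Hc).
  rewrite <- (gmulr1 G v), edges_translate in Ha. apply in_map_iff in Ha.
  destruct Ha as (c & <- & Hcz). apply cos_mul_l in Hc. simpl in Hc.
  refine (Hv _ _ Hc). apply in_flat_map. exists b. split; trivial.
  now apply (in_map (fun a => fst b ** (fst a)^-1)).
Qed.

Definition marked (es : nat -> G * X) (N : nat) (a : G * X) : Prop :=
  exists n, n < N /\ orbit (es n) a.

Lemma marked_invariant (es : nat -> G * X) (N : nat) : invariant (marked es N).
Proof.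
  intros a b Hab (n & Hn & Ha). exists n. split; trivial.
  eapply orbit_trans; eassumption.
Qed.

(** Each crossing of the orbit of [(w, x)] that [B'] forbids is replaced by [z'] or its reverse.
    Since [z'] closes up only modulo [D], the endpoint is kept only as a coset. *)
Lemma detour (B B' : G * X -> Prop) (w : G) (x : X) (z' : list (X * bool)) :
  invariant B' -> (forall a, B' a -> B a \/ orbit (w, x) a) ->
  avoid B' (w ** g x) z' -> cos (w ** g x ** val g z') w ->
  forall z v, avoid B v z ->
    exists t, avoid B' v t /\ cos (v ** val g t) (v ** val g z).
Proof.
  intros HB' Hsub Hz' Hc z. induction z as [|[y b] z IH]; intros v Hz.
  { exists []. split; [intros a [] | apply cos_refl]. }
  rewrite avoid_cons in Hz. destruct Hz as [Hs Hz].
  destruct (IH _ Hz) as (t & Ht & Htc). simpl.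
  assert (Hstep : exists t0, avoid B' v t0 /\ cos (v ** val g t0) (v ** letter g (y, b))).
  { destruct (classic (B' (source v (y, b), y))) as [Hb|Hb].
    2:{ exists [(y, b)]. split; [rewrite avoid_cons; split; trivial; intros a [] |].
        simpl. rewrite gmulr1. apply cos_refl. }
    destruct (Hsub _ Hb) as [?|[Ey Hvw]]; [contradiction|]. simpl in Ey, Hvw. subst y.
    unfold source, letter in *. simpl in *. destruct b.
    - exists (inv_letters z'). apply avoid_inv in Hz'. split.
      + revert Hz'. apply avoid_cos; trivial. apply cos_trans with w; trivial.
        now apply cos_sym.
      + rewrite val_inv. apply cos_sym, cos_mul_l.
        apply cos_trans with w; [|now apply cos_sym].
        apply cos_trans with (w ** g x ** val g z'); [|exact Hc].
        now apply cos_mul, cos_mul.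
    - apply cos_mul_r in Hvw. exists z'. split.
      + revert Hz'. apply avoid_cos; trivial. now apply cos_sym.
      + apply cos_trans with (w ** g x ** val g z'); [now apply cos_mul|].
        apply cos_trans with w; trivial. apply cos_sym.
        apply (cos_mul _ _ (g x)^-1) in Hvw. now grp. }
  destruct Hstep as (t0 & Ht0 & Ht0c). exists (t0 ++ t).
  rewrite avoid_app, val_app. repeat split; trivial.
  - revert Ht. apply avoid_cos; trivial. now apply cos_sym.
  - apply (cos_mul _ _ (val g t)) in Ht0c. rewrite !gmulA.
    now apply cos_trans with (1 := Ht0c).
Qed.

(* Removing finitely many suitable edges from the Schreier graph leaves it
   connected: far away from the paths of the generators of [D] and from the edges
   already removed, the relator [rho] is still a closed path at every vertex, and
   provides a further edge that is not a bridge. *)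
Lemma marked_edges (rho : list (X * bool)) :
  fin_gen_subgroup G D -> infinite_index G D ->
  val g rho = e -> ~ trivial_word rho ->
  forall N, exists es : nat -> G * X,
    (forall i j, i < N -> j < N -> orbit (es i) (es j) -> i = j) /\
    (forall k, exists z, avoid (marked es N) e z /\ val g z = k).
Proof.
  intros Hfg Hinf Hrho Hnt N. destruct (subgroup_paths Hfg) as [l0 Hl0].
  (* The induction also keeps the removed edges off the orbits of [l0], so that every element of [D]
     stays reachable. *)
  enough (exists es : nat -> G * X,
    (forall i j, i < N -> j < N -> orbit (es i) (es j) -> i = j) /\
    (forall i a, i < N -> In a l0 -> ~ orbit (es i) a) /\
    (forall k, exists z, avoid (marked es N) e z /\ val g z = k))
    as (es & H1 & _ & H3) by (exists es; now split).
  induction N as [|N (es & Hinj & Hdisj & Hconn)].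
  (* With no edge removed yet, [es] still needs some value; its letter comes from the nonempty word
     [rho]. *)
  { destruct rho as [|[x0 b0] rho']; [exfalso; apply Hnt; intros H f; reflexivity|].
    exists (fun _ => (e, x0)). split; [|split]; try (intros; lia).
    intros k. destruct (Hgen k) as [z Hz]. exists z. split; trivial.
    intros a _ (n & Hn & _). lia. }
  set (l := l0 ++ map es (seq 0 N)).
  set (B := fun a => exists b, In b l /\ orbit b a).
  assert (HB : invariant B).
  { intros a b Hab (c & Hc & Hca). exists c. split; trivial.
    eapply orbit_trans; eassumption. }
  destruct (far_path l rho Hinf) as [v Hv].
  destruct (closed_path_bypass B rho v HB) as [T|(w & x & z' & Hwx & Hz' & Hc)];
    [rewrite Hrho, gmulr1; apply cos_refl | exact Hv | contradiction |].
  set (es' := fun n => if n =? N then (w, x) else es n).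
  assert (EN : es' N = (w, x)) by (unfold es'; now rewrite Nat.eqb_refl).
  assert (En : forall n, n < N -> es' n = es n).
  { intros n Hn. unfold es'. destruct (Nat.eqb_spec n N); [lia | reflexivity]. }
  assert (Hnew : forall n, n < N -> ~ orbit (es n) (w, x)).
  { intros n Hn Ho. apply Hwx. exists (es n). split; trivial.
    apply in_or_app. right. apply in_map, in_seq. lia. }
  assert (Hm : forall a, marked es' (S N) a -> marked es N a \/ orbit (w, x) a).
  { intros a (n & Hn & Ha). destruct (Nat.eq_dec n N) as [->|Hne].
    - right. now rewrite EN in Ha.
    - left. exists n. rewrite En in Ha by lia. split; [lia | exact Ha]. }
  assert (Hdisj' : forall i a, i < S N -> In a l0 -> ~ orbit (es' i) a).
  { intros i a Hi Ha Ho. destruct (Nat.eq_dec i N) as [->|Hne].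
    - rewrite EN in Ho. apply Hwx. exists a. split; [apply in_or_app; now left|].
      now apply orbit_sym.
    - rewrite En in Ho by lia. apply (Hdisj i a); trivial. lia. }
  exists es'. split; [|split; [exact Hdisj'|]].
  - intros i j Hi Hj Ho.
    destruct (Nat.eq_dec i N) as [->|Hi'], (Nat.eq_dec j N) as [->|Hj']; trivial;
      rewrite ?EN, ?En in Ho by lia.
    + apply orbit_sym in Ho. exfalso. apply (Hnew j); trivial. lia.
    + exfalso. apply (Hnew i); trivial. lia.
    + apply Hinj; trivial; lia.
  - intros k. destruct (Hconn k) as (z & Hz & Ez).
    assert (Hz'm : avoid (marked es' (S N)) (w ** g x) z').
    { revert Hz'. apply avoid_mono. intros a Ha. destruct (Hm a Ha) as [(n & Hn & Ho)|Ho].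
      - left. exists (es n). split; trivial.
        apply in_or_app. right. apply in_map, in_seq. lia.
      - now right. }
    (* The detour [t] ends in the coset of [k]; the missing left factor in [D] is supplied by a path
       [u] put in front. *)
    destruct (detour _ _ w x z' (marked_invariant es' (S N)) Hm Hz'm Hc z e Hz)
      as (t & Ht & Htc).
    rewrite Ez, !gmul1 in Htc. apply cos_sym in Htc.
    destruct (Hl0 _ (marked_invariant es' (S N))) with (k ** (val g t)^-1)
      as (u & Hu & Eu); [ | exact Htc |].
    { intros a Ha (n & Hn & Ho). now apply (Hdisj' n a). }
    exists (u ++ t). rewrite avoid_app, val_app, Eu. split; [split; trivial|now grp].
    revert Ht. apply avoid_cos; [apply marked_invariant|].
    rewrite gmul1. apply cos_sym, cos_D, Htc.
Qed.

End Schreier.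

(** * The relatively free case *)

Definition int_group : group :=
  Group Z Z.add 0%Z Z.opp Z.add_assoc Z.add_0_l Z.add_opp_diag_l.

Fixpoint gpow {G : group} (a : G) (n : nat) : G :=
  match n with
  | 0 => e
  | S n' => a ** gpow a n'
  end.

(* If [G] is free on [X], a two-generated wreath product [H wr Z] is an image of
   [G]; there the conjugates of a base element by powers of the shift take
   arbitrary values of [H] in the coordinate [0]. *)
Lemma free_group_laws (G : group) (X : Type) (g : X -> G) (x0 x1 : X) (u v : word) :
  x0 <> x1 -> (forall k, exists z, val g z = k) ->
  (forall z, val g z = e -> trivial_word X z) ->
  satisfies G (u, v) -> forall H : group, satisfies H (u, v).
Proof.
  intros Hx Hgen Hfree HG H h. simpl.
  set (W := wreath H int_group).
  set (shift := ((1%Z, fun _ => e) : W)).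
  (* Conjugating by the [n]-th power of [shift] brings [h n] to coordinate [0], the only one read in
     the end; the values at negative integers are immaterial. *)
  set (b := ((0%Z, fun k => h (Z.to_nat k)) : W)).
  destruct (hom_extension G W X g
    (fun x => if excluded_middle_informative (x = x0) then shift else b) Hgen)
    as (psi & Hpsi & Hpsig).
  { intros z Hz. apply (Hfree z Hz). }
  set (t := fun n => gpow (g x0) n ** g x1 ** (gpow (g x0) n)^-1).
  assert (Hpow : forall n, psi (gpow (g x0) n) = ((Z.of_nat n, fun _ => e) : W)).
  { induction n as [|n IH]; simpl; [exact (hom1 G W psi Hpsi)|].
    rewrite Hpsi, IH, Hpsig. destruct excluded_middle_informative; [|congruence].
    apply injective_projections; [|extensionality y; apply gmul1].
    cbn -[Z.of_nat Z.add]. lia. }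
  assert (Ht : forall n, psi (t n)
    = ((0%Z, fun y => h (Z.to_nat (y + Z.of_nat n))) : W)).
  { intros n. unfold t. rewrite !Hpsi, (homV _ _ psi), Hpow, Hpsig by exact Hpsi.
    destruct excluded_middle_informative; [congruence|].
    apply injective_projections.
    - cbn -[Z.of_nat Z.add]. lia.
    - extensionality y. cbn -[Z.of_nat Z.add]. now rewrite ginv1, gmulr1, gmul1. }
  assert (E : forall w, base (psi (eval G t w)) 0%Z = eval H h w).
  { intros w. rewrite (hom_eval _ _ psi) by exact Hpsi.
    rewrite (wreath_eval_base H int_group).
    - apply eval_ext. intros n. rewrite Ht. unfold base; simpl. f_equal. lia.
    - intros n. rewrite Ht. reflexivity. }
  rewrite <- !E. now rewrite (HG t : eval G t u = eval G t v).
Qed.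

(** * The discriminating group *)

Lemma base_mul (M G : group) (a b : wreath M G) (y : G) :
  base (a ** b) y = base a y ** base b (y ** top a).
Proof. reflexivity. Qed.

Lemma base_inv (M G : group) (a : wreath M G) (y : G) :
  base (a^-1) y = (base a (y ** (top a)^-1))^-1.
Proof. reflexivity. Qed.

(** The base part at [v] is the product of the labels of the edges crossed from [v], inverted on
    backward crossings. *)
Lemma wreath_val_avoid (M G : group) (X : Type) (g : X -> G) (B : G * X -> Prop)
    (b : G -> X -> M) (z : list (X * bool)) (v : G) :
  (forall w x, ~ B (w, x) -> b w x = e) -> avoid G X g B v z ->
  base (val (fun x => (g x, fun y => b y x) : wreath M G) z) v = e.
Proof.
  intros Hb. revert v. induction z as [|[x c] z IH]; intros v; [reflexivity|].
  rewrite avoid_cons. intros [Hs Hz]. rewrite val_cons, base_mul.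
  assert (E : base (letter (fun x => (g x, fun y => b y x) : wreath M G) (x, c)) v = e).
  { apply Hb in Hs. unfold source in Hs. destruct c; simpl in Hs.
    - exact Hs.
    - unfold letter. simpl fst. simpl snd. cbv iota. rewrite base_inv.
      change ((b (v ** (g x)^-1) x)^-1 = e). now rewrite Hs, ginv1. }
  rewrite E, gmul1. replace (top _) with (letter g (x, c)); [now apply IH|].
  now destruct c.
Qed.

(** The assignment [y] is fixed before any group of [UV] is considered. Each such group, with an
    assignment [h] into it, is then handled by one wreath product, reached through the universal
    property of [K]. *)
Lemma covering_discriminates (U V : variety) (G : group) (D : G -> Prop) (X : Type)
    (g : X -> G) (rho : list (X * bool)) (K : group) (kappa : X -> K) (p : K -> G) :
  (forall k, exists z, val g z = k) ->
  is_subgroup G D -> fin_gen_subgroup G D -> infinite_index G D ->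
  discriminates G D (freeEq V) ->
  val g rho = e -> ~ trivial_word X rho ->
  is_hom K G p -> (forall x, p (kappa x) = g x) ->
  (forall (H : group) (phi : H -> G) (f : X -> H),
     is_hom H G phi -> ker_laws U H G phi -> (forall x, phi (f x) = g x) ->
     exists psi : K -> H, is_hom K H psi /\ forall x, psi (kappa x) = f x) ->
  discriminates K (fun _ => True) (freeEqProd U V).
Proof.
  intros Hgen HD Hfg Hinf Hdisc Hrho Hnt Hp Hpk Huniv ws.
  (* All prefixes are separated, from the empty one to the whole word, because the value in [D] of
     the part already read must determine its value in [Q]. *)
  destruct (Hdisc (flat_map (fun u => map (fun k => word_of (firstn k (letters u)))
    (seq 0 (S (length (letters u))))) ws)) as (d & Hd & Hinj).
  set (P := fun t => exists s u, In u ws /\ letters u = t ++ s).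
  assert (HP : forall t t', P t -> P t' -> val d t = val d t' ->
    freeEq V (word_of t) (word_of t')).
  { assert (Hin : forall t, P t -> In (word_of t)
      (flat_map (fun u => map (fun k => word_of (firstn k (letters u)))
        (seq 0 (S (length (letters u))))) ws)).
    { intros t (s & u & Hu & E). apply in_flat_map. exists u. split; trivial.
      apply in_map_iff. exists (length t). rewrite E, firstn_app, Nat.sub_diag, firstn_all.
      simpl firstn. rewrite app_nil_r. split; trivial.
      apply in_seq. rewrite length_app. lia. }
    intros t t' Ht Ht' E. apply Hinj; auto. now rewrite !eval_word_of. }
  assert (Hbound : exists N, forall u s, In u ws -> In s (letters u) -> fst s < N).
  { exists (S (list_max (map fst (flat_map letters ws)))). intros u s Hu Hs.
    apply Nat.lt_succ_r.
    assert (HF := proj1 (list_max_le (map fst (flat_map letters ws)) _) (le_n _)).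
    rewrite Forall_forall in HF. apply HF, in_map, in_flat_map. eauto. }
  destruct Hbound as [N HN].
  destruct (marked_edges G D HD X g Hgen rho Hfg Hinf Hrho Hnt N) as (es & Hes & Hconn).
  set (B := marked G D X es N) in *.
  assert (Hy : forall n, exists z, val g z = d n /\ (n < N -> exists z1 z2,
    z = z1 ++ (snd (es n), true) :: z2 /\ val g z1 = fst (es n) /\
    avoid G X g B e z1 /\ avoid G X g B (fst (es n) ** g (snd (es n))) z2)).
  { intros n. destruct (lt_dec n N) as [Hn|Hn].
    2:{ destruct (Hgen (d n)) as [z Hz]. exists z. split; [exact Hz | lia]. }
    destruct (Hconn (fst (es n))) as (z1 & Hz1 & E1).
    destruct (Hconn (fst (es n) ** g (snd (es n)))) as (z2 & Hz2 & E2).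
    destruct (Hconn (d n)) as (z3 & Hz3 & E3).
    (* The path goes to the source of [es n], crosses it, returns to [e] by the reverse of [z2], and
       continues to [d n]. *)
    exists (z1 ++ (snd (es n), true) :: (inv_letters z2 ++ z3)). split.
    - rewrite val_app. simpl. rewrite val_app, val_inv, E1, E2, E3.
      unfold letter; simpl. now grp.
    - intros _. exists z1, (inv_letters z2 ++ z3). repeat split; trivial.
      rewrite avoid_app, val_inv, E2, gmulrV. split; trivial.
      apply avoid_inv in Hz2. now rewrite gmul1, E2 in Hz2. }
  destruct (choice _ Hy) as [y Hyspec]. clear Hy.
  exists (fun n => val kappa (y n)). split; [trivial|].
  intros u v Hu Hv EK H (Q & phi & Hphi & Hsurj & HQ & HU) h. simpl.
  assert (EG : eval G d u = eval G d v).
  { apply (f_equal p) in EK. rewrite !(hom_eval _ _ p) in EK by exact Hp.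
    assert (Ed : forall n, p (val kappa (y n)) = d n).
    { intros n. rewrite (hom_val _ _ p) by exact Hp.
      rewrite (val_ext _ g) by exact Hpk. apply Hyspec. }
    now rewrite (eval_ext G _ d u Ed), (eval_ext G _ d v Ed) in EK. }
  destruct (choice _ Hsurj) as [sec Hsec].
  (* [q] turns the value in [G] of a prefix into its value in [Q]; this is consistent by [HP], as
     [Q] is in [V]. Elsewhere [q] is [e]. *)
  assert (Hq : forall k, exists c, forall t, P t -> val d t = k ->
    val (fun n => phi (h n)) t = c).
  { intros k. destruct (classic (exists t, P t /\ val d t = k)) as [(t & Ht & Et)|Hno].
    - exists (val (fun n => phi (h n)) t). intros t' Ht' Et'.
      rewrite <- !eval_word_of.
      apply (HP t' t Ht' Ht (eq_trans Et' (eq_sym Et)) Q HQ (fun n => phi (h n))).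
    - exists e. intros t Ht Et. exfalso. eauto. }
  destruct (choice _ Hq) as [q Hqspec]. clear Hq.
  set (M := ker_group H Q phi Hphi).
  (* The Kaloujnine-Krasner cocycle of [h n] for the section [sec]. *)
  assert (Ha : forall n k,
    phi (sec (q k) ** h n ** (sec (q k ** phi (h n)))^-1) = e).
  { intros n k. rewrite !Hphi, (homV _ _ phi), !Hsec by exact Hphi. apply gmulrV. }
  set (a := fun n k => exist _ _ (Ha n k) : M).
  (* An edge in the orbit of [es n] is the translate of [es n] by a unique [k] in [D] and is
     labelled [a n k]; by [Hes] only one [n] applies. All other edges get [e]. *)
  assert (Hb : forall c : G * X, exists m : M,
    (forall n, n < N -> orbit G D X (es n) c -> m = a n (fst c ** (fst (es n))^-1)) /\
    (~ B c -> m = e)).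
  { intros c. destruct (classic (B c)) as [(n & Hn & Hc)|Hc].
    - exists (a n (fst c ** (fst (es n))^-1)). split.
      + intros n' Hn' Hc'. replace n' with n; trivial. apply Hes; trivial.
        eapply orbit_trans; [exact HD | exact Hc | now apply orbit_sym].
      + intros Hno. exfalso. apply Hno. exists n. now split.
    - exists e. split; trivial. intros n Hn Ho. exfalso. apply Hc. exists n. now split. }
  destruct (choice _ Hb) as [b Hbspec]. clear Hb.
  set (f := fun x => (g x, fun w => b (w, x)) : wreath M G).
  destruct (Huniv (wreath M G) top f) as (psi & Hpsi & Hpsik).
  { apply top_hom. }
  { now apply wreath_ker_laws, ker_group_inV. }
  { reflexivity. }
  set (F := fun n => val f (y n)).
  assert (Htop : forall z, top (val f z) = val g z).
  { intros z. rewrite (hom_val _ _ top) by apply top_hom. now apply val_ext. }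
  assert (HtopF : forall n, top (F n) = d n).
  { intros n. unfold F. rewrite Htop. apply Hyspec. }
  (* Read from [k], the path [y n] carries a single label that can be nontrivial, at the translate
     of [es n] by [k]. *)
  assert (HbaseF : forall n k, n < N -> D k -> base (F n) k = a n k).
  { intros n k Hn Hk. destruct (Hyspec n) as (_ & Hyn).
    destruct (Hyn Hn) as (z1 & z2 & E & E1 & Hz1 & Hz2).
    assert (Hav : forall v z, avoid G X g B v z -> base (val f z) (k ** v) = e).
    { intros v0 z Hz. apply (wreath_val_avoid M G X g B (fun w x => b (w, x))).
      - intros w x Hwx. now apply Hbspec.
      - revert Hz. apply avoid_cos with D; [exact HD | now apply marked_invariant |].
        apply cos_sym; [exact HD|]. unfold cos. now grp. }
    unfold F. rewrite E, val_app, base_mul, val_cons, base_mul, Htop, E1.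
    rewrite <- (gmulr1 G k) at 1. rewrite Hav by exact Hz1.
    change (top (letter f (snd (es n), true))) with (g (snd (es n))).
    rewrite gmul_assoc, Hav by exact Hz2.
    rewrite gmul1, gmulr1.
    change (b (k ** fst (es n), snd (es n)) = a n k).
    rewrite (proj1 (Hbspec (k ** fst (es n), snd (es n))) n Hn).
    - simpl. now grp.
    - split; [reflexivity|]. unfold cos; simpl. now grp. }
  assert (HDval : forall t, D (val d t)).
  { destruct HD as (HD1 & HDM & HDV).
    induction t as [|[n c] t IH]; simpl; trivial. apply HDM; trivial.
    unfold letter; simpl. destruct c; auto. }
  assert (Hqval : forall t, P t -> q (val d t) = val (fun n => phi (h n)) t).
  { intros t Ht. symmetry. now apply Hqspec. }
  (* [t0] is the part already read and [t] the part to come; the sections at successive prefixes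
     telescope. *)
  assert (Htrack : forall t t0, P (t0 ++ t) ->
    ker_incl H Q phi Hphi (base (val F t) (val d t0)) =
    sec (q (val d t0)) ** val h t ** (sec (q (val d (t0 ++ t))))^-1).
  { induction t as [|[n c] t IH]; intros t0 Ht0.
    { simpl. rewrite app_nil_r, gmulr1, gmulrV. reflexivity. }
    assert (Hn : n < N).
    { destruct Ht0 as (s & w & Hw & E). apply (HN w (n, c)); trivial.
      rewrite E. apply in_or_app. left. apply in_or_app. right. now left. }
    assert (Hpre : P t0).
    { destruct Ht0 as (s & w & Hw & E). exists (((n, c) :: t) ++ s), w.
      now rewrite app_assoc. }
    assert (Happ : t0 ++ (n, c) :: t = (t0 ++ [(n, c)]) ++ t) by now rewrite <- app_assoc.
    rewrite Happ in Ht0 |- *.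
    assert (Hpre' : P (t0 ++ [(n, c)])).
    { destruct Ht0 as (s & w & Hw & E). exists (t ++ s), w. now rewrite app_assoc. }
    assert (Hnext : val d (t0 ++ [(n, c)]) = val d t0 ** letter d (n, c)).
    { rewrite val_app. simpl. now rewrite gmulr1. }
    rewrite !val_cons, base_mul, ker_incl_hom.
    replace (top (letter F (n, c))) with (letter d (n, c)).
    2:{ destruct c; [symmetry; apply HtopF|].
        change (letter F (n, false)) with (F n)^-1.
        now rewrite (homV _ _ top), HtopF by apply top_hom. }
    rewrite <- Hnext, IH by exact Ht0.
    replace (ker_incl H Q phi Hphi (base (letter F (n, c)) (val d t0)))
      with (sec (q (val d t0)) ** letter h (n, c) ** (sec (q (val d (t0 ++ [(n, c)]))))^-1);
      [now grp|].
    destruct c.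
    - change (letter F (n, true)) with (F n). change (letter h (n, true)) with (h n).
      rewrite HbaseF by auto. change (ker_incl H Q phi Hphi (a n (val d t0))) with
        (sec (q (val d t0)) ** h n ** (sec (q (val d t0) ** phi (h n)))^-1).
      rewrite !Hqval, val_app by trivial. simpl. unfold letter; simpl. now rewrite gmulr1.
    (* An inverse letter contributes the inverse of the cocycle at the vertex it leads to, not at
       the one it leaves. *)
    - change (letter F (n, false)) with (F n)^-1.
      change (letter d (n, false)) with (d n)^-1 in Hnext.
      rewrite base_inv, HtopF, <- Hnext, HbaseF by auto.
      rewrite (homV _ _ (ker_incl H Q phi Hphi)) by apply ker_incl_hom.
      change (ker_incl H Q phi Hphi (a n (val d (t0 ++ [(n, false)])))) with
        (sec (q (val d (t0 ++ [(n, false)]))) ** h n **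
           (sec (q (val d (t0 ++ [(n, false)])) ** phi (h n)))^-1).
      rewrite !Hqval, val_app by trivial. simpl. unfold letter; simpl. now grp. }
  assert (Hlet : forall w, In w ws -> P ([] ++ letters w)).
  { intros w Hw. exists [], w. now rewrite app_nil_r. }
  assert (EF : val F (letters u) = val F (letters v)).
  { apply (f_equal psi) in EK. rewrite !(hom_eval _ _ psi) in EK by exact Hpsi.
    rewrite !val_letters.
    assert (EFn : forall n, psi (val kappa (y n)) = F n).
    { intros n. rewrite (hom_val _ _ psi) by exact Hpsi. now apply val_ext. }
    now rewrite (eval_ext _ _ F u EFn), (eval_ext _ _ F v EFn) in EK. }
  (* Both products start at the same section, and they end at the same one by [EG]; cancelling
     leaves the values of [u] and [v] under [h]. *)
  generalize (Htrack _ _ (Hlet u Hu)), (Htrack _ _ (Hlet v Hv)).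
  rewrite EF. intros -> E2. simpl in E2. rewrite !val_letters, EG in E2.
  apply gmul_cancel_r, gmul_cancel in E2. now symmetry.
Qed.

(** * Generators *)

Lemma bounded_nat_enum (m : nat) :
  exists xs : list {i | i < m}, length xs = m /\ forall x, In x xs.
Proof.
  assert (Hlift : forall l, (forall i, In i l -> i < m) ->
    exists xs : list {i | i < m}, map (@proj1_sig _ _) xs = l).
  { induction l as [|i l IH]; intros Hl; [now exists []|].
    destruct IH as [xs <-]; [intros; apply Hl; now right|].
    exists (exist _ i (Hl i (or_introl eq_refl)) :: xs). reflexivity. }
  destruct (Hlift (seq 0 m)) as [xs Hxs]; [intros i Hi; apply in_seq in Hi; lia|].
  exists xs. split.
  - now rewrite <- (length_map (@proj1_sig _ _)), Hxs, length_seq.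
  - intros x. assert (Hx : In (proj1_sig x) (map (@proj1_sig _ _) xs)).
    { rewrite Hxs. apply in_seq. destruct x; simpl; lia. }
    apply in_map_iff in Hx. destruct Hx as (x' & E & Hx').
    now rewrite <- (sig_eq _ _ _ E).
Qed.

Lemma m_generated_of_letters (K : group) (X : Type) (kappa : X -> K) (xs : list X) :
  (forall x, In x xs) -> (forall k, exists z, val kappa z = k) ->
  m_generated K (length xs).
Proof.
  intros Hxs Hgen. exists (map kappa xs). split; [apply length_map|].
  intros k. split; trivial. intros _. destruct (Hgen k) as [z <-].
  induction z as [|[x b] z [w IH]]; [now exists WOne|].
  destruct (In_nth _ _ e (in_map kappa _ _ (Hxs x))) as (n & _ & En).
  exists (WMul (if b then Var n else WInv (Var n)) w). simpl. rewrite IH.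
  destruct b; simpl; now rewrite En.
Qed.

Lemma letters_of_m_generated (G : group) (m : nat) :
  m_generated G m ->
  exists g : {i | i < m} -> G, forall k, exists z, val g z = k.
Proof.
  intros (L & HL & Hgen). exists (fun x => nth (proj1_sig x) L e). intros k.
  destruct (proj1 (Hgen k) I) as [w <-].
  induction w as [n| |u (zu & Eu) v (zv & Ev)|u (zu & Eu)]; simpl.
  - destruct (lt_dec n m) as [Hn|Hn].
    + exists [(exist _ n Hn, true)]. apply gmulr1.
    (* Beyond the [m] generators [nth] returns the default [e]. *)
    + exists []. symmetry. apply nth_overflow. lia.
  - now exists [].
  - exists (zu ++ zv). now rewrite val_app, Eu, Ev.
  - exists (inv_letters zu). now rewrite val_inv, Eu.
Qed.

Theorem theorem3 (U V : variety) (G : group) (m : nat) (D : G -> Prop) :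
  2 <= m ->
  inV V G ->
  m_generated G m ->
  is_subgroup G D ->
  fin_gen_subgroup G D ->
  infinite_index G D ->
  discriminates G D (freeEq V) ->
  (exists K : group,
      inProd U V K /\ m_generated K m /\
      discriminates K (fun _ => True) (freeEqProd U V)) /\
  (* basis rank of UV at most m: UV is generated by its m-generated groups *)
  (forall u v : word,
      (forall K : group, inProd U V K -> m_generated K m -> satisfies K (u, v)) ->
      freeEqProd U V u v).
Proof.
  intros Hm HG HGm HD Hfg Hinf Hdisc.
  enough (HK : exists K : group, inProd U V K /\ m_generated K m /\
    discriminates K (fun _ => True) (freeEqProd U V)).
  { split; [exact HK|]. intros u v Huv. destruct HK as (K & HK & HKm & HKd).
    (* An assignment into [K] that separates [u] from [v] unless they are equal in the free group,
       whereas [K] satisfies [u = v]. *)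
    destruct (HKd [u; v]) as (f & _ & Hf).
    apply Hf; simpl; auto. exact (Huv K HK HKm f). }
  destruct (letters_of_m_generated G m HGm) as [g Hgen].
  destruct (classic (exists rho, val g rho = e /\ ~ trivial_word _ rho))
    as [(rho & Hrho & Hnt)|Hfree].
  - destruct (covering_group U G _ g Hgen) as (K & kappa & p & HKgen & Hp & Hpk & HpU & Huniv).
    exists K. split; [|split].
    + exists G, p. repeat split; trivial. intros k. destruct (Hgen k) as [z <-].
      exists (val kappa z). rewrite (hom_val _ _ p) by exact Hp. now apply val_ext.
    + destruct (bounded_nat_enum m) as (xs & Hlen & Hxs).
      rewrite <- Hlen. now apply (m_generated_of_letters K _ kappa).
    + now apply (covering_discriminates U V G D _ g rho K kappa p).
  - exists G. split; [|split; [exact HGm|]].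
    + exists G, (fun x => x). split; [intros x y; reflexivity|].
      split; [eauto|]. split; [exact HG | apply id_ker_laws].
    + intros ws. destruct (Hdisc ws) as (d & _ & Hd). exists d. split; [trivial|].
      (* Equal values under [d] give a law of [V], hence of the free group [G], hence of every
         group; [2 <= m] supplies the two letters. *)
      intros u v Hu Hv E H _.
      assert (H0 : 0 < m) by lia. assert (H1 : 1 < m) by lia.
      apply (free_group_laws G _ g (exist _ 0 H0) (exist _ 1 H1)); trivial.
      * intros Ex. now apply (f_equal (@proj1_sig _ _)) in Ex.
      * intros z Hz. apply NNPP. intros Hnt. apply Hfree. now exists z.
      * now apply Hd.
Qed.
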